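(* There is an absolute constant $K>0$ such that the following holds for all $n\ge 2$, $C>0$ and $\delta\in(0,1)$. Let $\bm P$ be a feasible point of (REG-MOD), let $\bm A\sim\bm P$, and let $\bm P^*$ be an optimal solution of (REG-MOD) for the observed $\bm A$. Then with probability at least $1-\delta$, $$D(\bm P\parallel\bm P^* )\le\frac{K\,\mathbb E[\operatorname{tr}\bm P^*]\log n}{\delta\sqrt n}+\frac{C\operatorname{tr}\bm P-C\operatorname{tr}\bm P^*}{n(n-1)}-\frac{L_{\bm A}(\bm P)+H[\bm P]}{n(n-1)} ,$$ where the expectation is over $\bm A\sim \bm P$.
   Context: $\bm A\sim\bm P$ means: $\bm A$ is the symmetric $0/1$ adjacency matrix (zero diagonal) of a random simple graph on $\{1,\dots,n\}$ whose entries $A_{ij}$, $i<j$, are independent Bernoulli variables with parameters $P_{ij}$. $i\sim j$ means $A_{ij}=1$, and $i\not\sim j$ means $i\ne j$ and $A_{ij}=0$. All sums over $i\ne j$, $i\sim j$, $i\not\sim j$ are over ordered pairs. (REG-MOD): maximize $\sum_{i\sim j}\log P_{ij}+\sum_{i\not\sim j}\log(1-P_{ij})-C\operatorname{tr}\bm P$ over real symmetric positive semidefinite $n\times n$ matrices $\bm P$ with $\frac1n\le P_{ij}\le 1-\frac1n$ for all $i\ne j$. $L_{\bm A}(\bm M)=\sum_{i\neq j}\bigl[A_{ij}\log M_{ij}+(1-A_{ij})\log(1-M_{ij})\bigr]$. $H[\bm P]=-\sum_{i\ne j}\bigl[P_{ij}\log P_{ij}+(1-P_{ij})\log(1-P_{ij})\bigr]$.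 $D(\bm X\parallel\bm Y)=-\frac1{n(n-1)}\sum_{i\ne j}\Bigl[X_{ij}\log\frac{Y_{ij}}{X_{ij}}+(1-X_{ij})\log\frac{1-Y_{ij}}{1-X_{ij}}\Bigr]$ (mean off-diagonal Bernoulli KL divergence). *)

(* Defs.v *)
From HB Require Import structures.
From mathcomp Require Import all_boot all_order all_algebra.
From mathcomp Require Import all_classical all_reals all_analysis.

Set Implicit Arguments.
Unset Strict Implicit.
Unset Printing Implicit Defensive.

Import Order.TTheory GRing.Theory Num.Theory.
Import numFieldNormedType.Exports.

Local Open Scope classical_set_scope.
Local Open Scope ring_scope.

Section RegMod.
Context {R : realType} {n : nat}.
Implicit Types (A P M X Y : 'M[R]_n) (C : R).

Definition psdmx P : Prop :=
  P^T = P /\ forall x : 'cV[R]_n, 0 <= (x^T *m P *m x) 0 0.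

Definition feasible P : Prop :=
  psdmx P /\ forall i j : 'I_n, i != j -> n%:R^-1 <= P i j <= 1 - n%:R^-1.

Definition adjacency A : Prop :=
  [/\ A^T = A, forall i, A i i = 0 & forall i j, A i j = 0 \/ A i j = 1].

(* Sums range over ordered pairs, as in all the sums over i != j below. *)
Definition regmod_obj C A P : R :=
  \sum_i \sum_(j | A i j == 1) ln (P i j)
  + \sum_i \sum_(j | (i != j) && (A i j == 0)) ln (1 - P i j)
  - C * \tr P.

Definition regmod_optimal C A P : Prop :=
  feasible P /\ forall Q : 'M[R]_n, feasible Q ->
    regmod_obj C A Q <= regmod_obj C A P.

Definition loglik A M : R :=
  \sum_i \sum_(j | i != j)
    (A i j * ln (M i j) + (1 - A i j) * ln (1 - M i j)).

Definition entropy P : R :=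
  - \sum_i \sum_(j | i != j)
      (P i j * ln (P i j) + (1 - P i j) * ln (1 - P i j)).

Definition meanKL X Y : R :=
  - (n%:R * (n%:R - 1))^-1 *
  \sum_i \sum_(j | i != j)
    (X i j * ln (Y i j / X i j)
     + (1 - X i j) * ln ((1 - Y i j) / (1 - X i j))).

End RegMod.

Section Probability.
Context {d : measure_display} {T : measurableType d} {R : realType}.
Variable Pr : probability T R.

(* Mutual independence of the real random variables X k, k in K. *)
Definition mutually_independent (I : finType) (K : {set I}) (X : I -> T -> R) :
    Prop :=
  forall (J : {set I}) (B : I -> set R), J \subset K ->
    (forall k, measurable (B k)) ->
    Pr [set w | forall k, k \in J -> B k (X k w)] =
    (\prod_(k in J) Pr (X k @^-1` B k))%E.

(* Entrywise measurability, for the Borel sets of R. *)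
Definition random_matrix (n : nat) (M : T -> 'M[R]_n) : Prop :=
  forall i j, measurable_fun [set: T] (fun w => M w i j).

(* A ~ P: only the entries above the diagonal are independent Bernoulli
   variables; the others are determined by [adjacency]. *)
Definition random_graph (n : nat) (P : 'M[R]_n) (A : T -> 'M[R]_n) : Prop :=
  [/\ random_matrix A,
      forall w, adjacency (A w),
      forall i j : 'I_n, (i < j)%N -> Pr [set w | A w i j = 1] = (P i j)%:E
    & mutually_independent [set k : 'I_n * 'I_n | (k.1 < k.2)%N]%SET
        (fun k w => A w k.1 k.2)].

End Probability.

(* Main.v *)
(** By optimality of [P^*], [n(n-1) D(P || P^* )] is at most the two last terms
    of the bound plus the noise
    [Y = \sum_(i != j) (A - P)_ij logit (P^*_ij)], so it suffices to bound
    [Y - lam * tr P^*] by a nonnegative variable of mean at most [lam], with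
    [lam] of order [n^(3/2) ln n], and to apply Markov's inequality.
    If [tr P^* > sqrt n] then [Y <= lam * tr P^*] trivially.  Otherwise consider
    the supremum over all feasible [M] with [tr M <= sqrt n] of
    [\sum (A - P) logit M - lam * tr M].  As [logit] is [2n]-Lipschitz on
    [[1/n, 1 - 1/n]], a contraction principle, which tolerates the additive
    penalty, bounds its mean by that of the supremum of
    [\sum eps (ln n + 2n M) - lam * tr M] for random signs [eps]; for positive
    semidefinite [M] this is governed by the largest value of the quadratic form
    of [eps] on unit vectors, which is of order [sqrt n] up to an error with
    exponentially small moments. *)

Require Import Defs.
From mathcomp Require Import all_boot all_order all_algebra.
From mathcomp Require Import all_classical all_reals all_analysis.
From mathcomp Require Import measurable_realfun.
From mathcomp Require Import ring lra.

Set Implicit Arguments.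
Unset Strict Implicit.
Unset Printing Implicit Defensive.

Import Order.TTheory GRing.Theory Num.Theory.
Import numFieldNormedType.Exports.

Local Open Scope classical_set_scope.
Local Open Scope ring_scope.

(** * Suprema of real functions over a type *)

Section Supremum.
Context {R : realType} {X : Type}.
Implicit Types (F G : X -> R).

Lemma eq_supr F G : F =1 G -> sup (range F) = sup (range G).
Proof. by move=> FG; rewrite (funext FG). Qed.

Lemma le_supr F B x : (forall y, F y <= B) -> F x <= sup (range F).
Proof.
move=> FB; apply: ub_le_sup; last by exists x.
by exists B => _ [y _ <-].
Qed.

Lemma supr_le F B (x0 : X) : (forall y, F y <= B) -> sup (range F) <= B.
Proof.
move=> FB; apply: ge_sup; first by exists (F x0), x0.
by move=> _ [y _ <-].
Qed.

Lemma mul_supr_le F (c B : R) (x0 : X) :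
  0 <= c -> (forall x, c * F x <= B) -> c * sup (range F) <= B.
Proof.
rewrite le_eqVlt => /orP[/eqP<- H|c0 H]; first by have := H x0; rewrite !mul0r.
rewrite -ler_pdivlMl //; apply: (supr_le x0) => x.
by rewrite ler_pdivlMl.
Qed.

(** The two suprema range independently, so a bound over pairs of points suffices. The two outcomes
    of one Bernoulli variable are compared in this form. *)
Lemma mul_supr_add_le F G (c d B : R) (x0 : X) : 0 <= c -> 0 <= d ->
  (forall x y, c * F x + d * G y <= B) ->
  c * sup (range F) + d * sup (range G) <= B.
Proof.
move=> c0 d0 H; rewrite -lerBrDr; apply: (mul_supr_le x0) => // x.
rewrite lerBrDr addrC -lerBrDr; apply: (mul_supr_le x0) => // y.
by rewrite lerBrDr addrC.
Qed.

End Supremum.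

(** * Contraction principle for centred Bernoulli variables *)

Section Contraction.
Context {R : realType}.

(* The two extreme cases of the bound are [x = y], available with weight
   [|1 - 2p|], and the pair [(x, y)] or [(y, x)] according to the sign of
   [psi x - psi y]; a centred Bernoulli variable is a mixture of both. *)
Lemma bernoulli_contraction (X : Type) (x0 : X) (phi psi g : X -> R) (p B : R) :
  0 <= p <= 1 ->
  (forall x y, `|phi x - phi y| <= `|psi x - psi y|) ->
  (forall x, `|psi x| <= B) -> (forall x, g x <= B) ->
  p * sup (range (fun x => (1 - p) * phi x + g x))
    + (1 - p) * sup (range (fun x => (0 - p) * phi x + g x))
  <= 2^-1 * sup (range (fun x => psi x + g x))
    + 2^-1 * sup (range (fun x => - psi x + g x)).
Proof.
move=> /andP[p0 p1] Hlip psiB gB.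
set S1 := sup (range (fun x => psi x + g x)).
set S2 := sup (range (fun x => - psi x + g x)).
have HS1 x : psi x + g x <= S1.
  apply: (@le_supr _ _ (fun x => psi x + g x) (B + B)) => y.
  by rewrite lerD // (le_trans (ler_norm _)).
have HS2 x : - psi x + g x <= S2.
  apply: (@le_supr _ _ (fun x => - psi x + g x) (B + B)) => y.
  by rewrite lerD // (le_trans (ler_norm _)) // normrN.
apply: (mul_supr_add_le x0) => //; first by rewrite subr_ge0.
move=> x y.
have Hl : phi x - phi y <= `|psi x - psi y|.
  by rewrite (le_trans (ler_norm _)).
have D : `|psi x - psi y| + g x + g y <= S1 + S2.
  have := HS1 x; have := HS1 y; have := HS2 x; have := HS2 y.
  by case: (ger0P (psi x - psi y)) => h; lra.
have Ex : g x + g x <= S1 + S2 by have := HS1 x; have := HS2 x; lra.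
have Ey : g y + g y <= S1 + S2 by have := HS1 y; have := HS2 y; lra.
have N0 : 0 <= `|psi x - psi y| by [].
have pq : p * (1 - p) * (phi x - phi y) <= p * (1 - p) * `|psi x - psi y|.
  by rewrite ler_wpM2l // mulr_ge0 // subr_ge0.
(* For [p <= 1/2], [p] times the pair bound plus [(1 - 2p)/2] times the bound at [y] puts weight [p]
   on [g x] and [1 - p] on [g y]. For larger [p] the weights are [1 - p] on the pair and
   [(2p - 1)/2] at [x]. *)
have [ph|ph] := lerP p (2^-1).
  have h1 : p * (`|psi x - psi y| + g x + g y) <= p * (S1 + S2).
    by rewrite ler_wpM2l.
  have h2 : (1 - 2 * p) * (g y + g y) <= (1 - 2 * p) * (S1 + S2).
    by rewrite ler_wpM2l //; lra.
  have h3 : p * (1 - p) * `|psi x - psi y| <= p * `|psi x - psi y|.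
    by rewrite ler_wpM2r //; nra.
  nra.
have h1 : (1 - p) * (`|psi x - psi y| + g x + g y) <= (1 - p) * (S1 + S2).
  by rewrite ler_wpM2l // subr_ge0.
have h2 : (2 * p - 1) * (g x + g x) <= (2 * p - 1) * (S1 + S2).
  by rewrite ler_wpM2l //; lra.
have h3 : p * (1 - p) * `|psi x - psi y| <= (1 - p) * `|psi x - psi y|.
  by rewrite ler_wpM2r //; nra.
nra.
Qed.

Context {K : finType}.
Implicit Types (b : {ffun K -> bool}) (q : K -> R) (F G : {ffun K -> bool} -> R).

Definition bern (p : R) (c : bool) : R := if c then p else 1 - p.

(** Expectation under a product of Bernoulli laws, kept as a finite sum so that the noise estimates
    involve no integrals. *)
Definition bexp q F : R := \sum_(b : {ffun K -> bool}) (\prod_k bern (q k) (b k)) * F b.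

Definition sgb (c : bool) : R := if c then 1 else -1.

Definition upd b (e : K) (c : bool) : {ffun K -> bool} :=
  [ffun k => if k == e then c else b k].

Lemma bern_ge0 p c : 0 <= p <= 1 -> 0 <= bern p c.
Proof. by case: c => /= /andP[? ?] //; rewrite subr_ge0. Qed.

(** On the right [b] runs over all configurations, so each pair differing only at [e] is met twice;
    hence the factor [1/2]. *)
Lemma sum_upd (e : K) F :
  \sum_(b : {ffun K -> bool}) F b = 2^-1 * \sum_(b : {ffun K -> bool}) (F (upd b e true) + F (upd b e false)).
Proof.
have inv : involutive (fun b => upd b e (~~ b e)).
  move=> b; apply/ffunP => k; rewrite !ffunE eqxx.
  by case: eqP => // ->; rewrite negbK.
have -> : \sum_(b : {ffun K -> bool}) (F (upd b e true) + F (upd b e false)) =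
    \sum_(b : {ffun K -> bool}) (F b + F (upd b e (~~ b e))).
  apply: eq_bigr => b _.
  have E : upd b e (b e) = b.
    by apply/ffunP => k; rewrite ffunE; case: eqP => // ->.
  by case be : (b e) E => E; rewrite E // addrC.
rewrite big_split /=.
have <- : \sum_(b : {ffun K -> bool}) F b = \sum_(b : {ffun K -> bool}) F (upd b e (~~ b e)).
  exact: reindex_inj (inv_inj inv).
by set s := \sum_b _; lra.
Qed.

(** Averages over the coordinate [e] first; the remaining weight does not depend on [b e]. *)
Lemma bexpE (e : K) q F : bexp q F =
  2^-1 * \sum_(b : {ffun K -> bool}) (\prod_(k | k != e) bern (q k) (b k)) *
    (q e * F (upd b e true) + (1 - q e) * F (upd b e false)).
Proof.
rewrite /bexp (sum_upd e); congr (_ * _); apply: eq_bigr => b _.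
have E c : \prod_k bern (q k) (upd b e c k) =
    bern (q e) c * \prod_(k | k != e) bern (q k) (b k).
  rewrite (bigD1 e) //= ffunE eqxx; congr (_ * _).
  by apply: eq_bigr => k ke; rewrite ffunE (negPf ke).
by rewrite !E /=; ring.
Qed.

Lemma le_bexp q F G : (forall k, 0 <= q k <= 1) -> (forall b, F b <= G b) ->
  bexp q F <= bexp q G.
Proof.
move=> q01 FG; apply: ler_sum => b _; apply: ler_wpM2l => //.
by apply: prodr_ge0 => k _; exact: bern_ge0.
Qed.

Section Hybrid.
Variables (X : Type) (x0 : X) (phi psi : K -> X -> R) (g : X -> R).
Variables (p : K -> R) (B : R).
Hypothesis p01 : forall k, 0 <= p k <= 1.
Hypothesis lip : forall k x y,
  `|phi k x - phi k y| <= `|psi k x - psi k y|.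
Hypothesis phiB : forall k x, `|phi k x| <= B.
Hypothesis psiB : forall k x, `|psi k x| <= B.
Hypothesis gB : forall x, g x <= B.

(** Interpolation: the coordinates in [r] already carry fair signs and [psi], the others still
    centred Bernoulli variables and [phi]. *)
Let q (r : seq K) k : R := if k \in r then 2^-1 else p k.
Let term (r : seq K) (b : {ffun K -> bool}) k x : R :=
  if k \in r then sgb (b k) * psi k x else ((b k)%:R - p k) * phi k x.
Let hyb r b : R := sup (range (fun x => \sum_k term r b k x + g x)).

(** With the coordinates other than [e] frozen, their terms join [g] in one additive function [g'],
    and the claim becomes the contraction for a single Bernoulli variable. *)
Let hyb_step r e : e \notin r -> bexp (q r) (hyb r) <= bexp (q (e :: r)) (hyb (e :: r)).
Proof.
move=> er.
have B0 : 0 <= B by rewrite (le_trans _ (psiB e x0)).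
rewrite !(bexpE e) ler_pM2l ?invr_gt0 ?ltr0n //; apply: ler_sum => b _.
have -> : \prod_(k | k != e) bern (q (e :: r) k) (b k) =
    \prod_(k | k != e) bern (q r k) (b k).
  by apply: eq_bigr => k ke; rewrite /q inE (negPf ke).
apply: ler_wpM2l.
  apply: prodr_ge0 => k _; apply: bern_ge0; rewrite /q; case: ifP => // _.
  by rewrite invr_ge0 ler0n /= invf_le1 ?ler1n ?ltr0n.
pose g' x := \sum_(k | k != e) term r b k x + g x.
have E1 c : hyb r (upd b e c) =
    sup (range (fun x => (c%:R - p e) * phi e x + g' x)).
  rewrite /hyb; apply: eq_supr => x.
  rewrite (bigD1 e) //= /term (negPf er) ffunE eqxx -addrA; congr (_ + (_ + _)).
  by apply: eq_bigr => k ke; rewrite ffunE (negPf ke).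
have E2 c : hyb (e :: r) (upd b e c) =
    sup (range (fun x => sgb c * psi e x + g' x)).
  rewrite /hyb; apply: eq_supr => x.
  rewrite (bigD1 e) //= /term inE eqxx ffunE eqxx -addrA; congr (_ + (_ + _)).
  by apply: eq_bigr => k ke; rewrite inE ffunE (negPf ke).
have -> : q r e = p e by rewrite /q (negPf er).
have -> : q (e :: r) e = 2^-1 by rewrite /q inE eqxx.
rewrite !E1 !E2 /=.
have -> : 1 - 2^-1 = 2^-1 :> R by lra.
rewrite (@eq_supr _ _ (fun x => 1 * _ + _) (fun x => psi e x + g' x)); last first.
  by move=> x; rewrite mul1r.
rewrite (@eq_supr _ _ (fun x => -1 * _ + _) (fun x => - psi e x + g' x)); last first.
  by move=> x; rewrite mulN1r.
(* One constant has to dominate both [|psi e|] and [g'], which collects [g] and a term of size at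
   most [B] for each other coordinate. *)
apply: (@bernoulli_contraction _ x0 _ _ _ _ (B + \sum_(k : K) B + B)) => //.
  move=> x; rewrite (le_trans (psiB _ _)) // -addrA lerDl.
  by rewrite addr_ge0 // sumr_ge0.
move=> x; rewrite /g' lerD //.
have : \sum_(k | k != e) term r b k x <= \sum_(k | k != e) B.
  apply: ler_sum => k _; rewrite (le_trans (ler_norm _)) // /term.
  case: ifP => _; rewrite normrM.
    by case: (b k); rewrite ?normrN normr1 mul1r.
  rewrite -[leRHS]mul1r ler_pM //.
  have := p01 k; case: (b k) => /andP[? ?].
    by rewrite ger0_norm ?subr_ge0 // gerBl.
  by rewrite sub0r normrN ger0_norm.
move=> /le_trans; apply; rewrite [X in _ <= _ + X](bigD1 e) //=.
by rewrite addrA lerDr addr_ge0.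
Qed.

(* Coordinates are exchanged one at a time, as in the comparison principle of
   Ledoux and Talagrand, but without symmetrizing first. *)
Lemma bexp_contraction :
  bexp p (fun b => sup (range (fun x => \sum_k ((b k)%:R - p k) * phi k x + g x)))
  <= bexp (fun=> 2^-1)
       (fun b => sup (range (fun x => \sum_k sgb (b k) * psi k x + g x))).
Proof.
have H r : uniq r -> bexp (q [::]) (hyb [::]) <= bexp (q r) (hyb r).
  elim: r => // e r IH /= /andP[er /IH h]; exact: (le_trans h (hyb_step er)).
have := H (enum K) (enum_uniq _); congr (_ <= _); rewrite /bexp.
apply: eq_bigr => b _; congr (_ * _).
  by apply: eq_bigr => k _; rewrite /q mem_enum.
rewrite /hyb; apply: eq_supr => x; congr (_ + _).
by apply: eq_bigr => k _; rewrite /term mem_enum.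
Qed.

End Hybrid.

Lemma bexp_sum (I : Type) (s : seq I) (P : pred I) q
    (F : I -> {ffun K -> bool} -> R) :
  bexp q (fun b => \sum_(i <- s | P i) F i b) =
  \sum_(i <- s | P i) bexp q (F i).
Proof.
rewrite /bexp exchange_big /=; apply: eq_bigr => b _.
by rewrite mulr_sumr.
Qed.

Lemma bexpZ q (c : R) F : bexp q (fun b => c * F b) = c * bexp q F.
Proof. by rewrite /bexp mulr_sumr; apply: eq_bigr => b _; rewrite mulrCA. Qed.

Lemma bexp_prod q (h : K -> bool -> R) :
  bexp q (fun b => \prod_k h k (b k)) =
  \prod_k (q k * h k true + (1 - q k) * h k false).
Proof.
transitivity (\sum_(b : {ffun K -> bool})
    \prod_k (bern (q k) (b k) * h k (b k))).
  by apply: eq_bigr => b _; rewrite big_split.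
rewrite -(bigA_distr_bigA (fun k c => bern (q k) c * h k c)) /=.
by apply: eq_bigr => k _; rewrite big_bool.
Qed.

End Contraction.

(** * Quadratic forms above the diagonal and positive semidefinite kernels *)

Section QuadraticForm.
Context {R : realType} {n : nat}.
Implicit Types (c : 'I_n * 'I_n -> R) (M : 'I_n -> 'I_n -> R) (x z : 'I_n -> R).

Definition pairing c M : R := \sum_(k : 'I_n * 'I_n | (k.1 < k.2)%N) c k * M k.1 k.2.

Definition qform c x : R := pairing c (fun i j => x i * x j).

Definition sqnorm x : R := \sum_i x i ^+ 2.

Definition psdfun M : Prop :=
  (forall i j, M i j = M j i) /\
  forall x, 0 <= \sum_i \sum_j x i * M i j * x j.

Lemma pairingZ c (a : R) M :
  pairing c (fun i j => a * M i j) = a * pairing c M.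
Proof. by rewrite /pairing mulr_sumr; apply: eq_bigr => k _; ring. Qed.

Lemma pairingD c M N :
  pairing c (fun i j => M i j + N i j) = pairing c M + pairing c N.
Proof. by rewrite /pairing -big_split; apply: eq_bigr => k _; rewrite mulrDr. Qed.

Lemma eq_pairing c M N : (forall i j, M i j = N i j) -> pairing c M = pairing c N.
Proof. by move=> MN; apply: eq_bigr => k _; rewrite MN. Qed.

Lemma qformZ c (a : R) x : qform c (fun i => a * x i) = a ^+ 2 * qform c x.
Proof.
by rewrite /qform -pairingZ; apply: eq_pairing => i j; ring.
Qed.

Lemma sqnorm_ge0 x : 0 <= sqnorm x.
Proof. by apply: sumr_ge0 => i _; exact: sqr_ge0. Qed.

Lemma sqnorm_eq0 x : sqnorm x = 0 -> forall i, x i = 0.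
Proof.
move=> /eqP; rewrite psumr_eq0 => [/allP H i|i _]; last exact: sqr_ge0.
by apply/eqP; rewrite -sqrf_eq0; apply: H; rewrite mem_index_enum.
Qed.

Definition setx z (e : 'I_n) (t : R) i : R := if i == e then t else z i.

(* Only off-diagonal products occur, so [qform c] is affine in each variable. *)
Lemma qform_setx c z e (s t a b : R) : a + b = 1 ->
  qform c (setx z e (a * s + b * t)) =
  a * qform c (setx z e s) + b * qform c (setx z e t).
Proof.
move=> ab; rewrite /qform -!pairingZ -pairingD; apply: eq_bigr => -[i j] /= ij.
have a1 : a = 1 - b by rewrite -ab addrK.
congr (_ * _); rewrite /setx a1; case: eqP => [ie|_]; case: eqP => [je|_]; try ring.
by move: ij; rewrite ie je ltnn.
Qed.

(** The form being affine in each variable, one of the two roundings of a coordinate does not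
    decrease it; rounding the coordinates in turn reaches an integer vector. *)
Lemma qform_round c z :
  exists y : 'I_n -> int, (forall i, `|(y i)%:~R - z i| <= 1) /\
    qform c z <= qform c (fun i => (y i)%:~R).
Proof.
suff H (r : seq 'I_n) : exists2 y : 'I_n -> R, qform c z <= qform c y &
    forall i, if i \in r then exists2 m : int, y i = m%:~R & `|y i - z i| <= 1
              else y i = z i.
  have [y qy yP] := H (enum 'I_n).
  have /choice[m mP] : forall i, exists m : int, y i = m%:~R /\ `|y i - z i| <= 1.
    by move=> i; have := yP i; rewrite mem_enum => -[m ? ?]; exists m.
  exists m; split=> [i|]; first by have [<-] := mP i.
  suff -> : (fun i => (m i)%:~R) = y by [].
  by apply/funext => i; rewrite (mP i).1.
elim: r => [|e r [y qy yP]]; first by exists z.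
have [er|er] := boolP (e \in r).
  exists y => // i; rewrite inE; case: eqP => [->|_]; last exact: yP.
  by have := yP e; rewrite er.
have ye : y e = z e by have := yP e; rewrite (negPf er).
pose u : R := (Num.floor (z e))%:~R.
have u1 : u <= z e by exact: floor_le_tmp.
have u2 : z e < u + 1 by have := floorD1_gt (z e); rewrite intrD.
(* [z e] is the convex combination of [u] and [u + 1] with weights [u + 1 - z e] and [z e - u]. *)
have Q : qform c y <= Num.max (qform c (setx y e u)) (qform c (setx y e (u + 1))).
  have -> : y = setx y e ((u + 1 - z e) * u + (z e - u) * (u + 1)).
    by apply/funext => i; rewrite /setx; case: eqP => // ->; rewrite ye; ring.
  rewrite qform_setx; last by ring.
  set A := qform _ _; set B := qform _ _.
  have -> : setx (setx y e ((u + 1 - z e) * u + (z e - u) * (u + 1))) e u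
     = setx y e u by apply/funext => i; rewrite /setx; case: eqP.
  have -> : setx (setx y e ((u + 1 - z e) * u + (z e - u) * (u + 1))) e (u + 1)
     = setx y e (u + 1) by apply/funext => i; rewrite /setx; case: eqP.
  rewrite -/A -/B le_max.
  by have [AB|AB] := lerP A B; apply/orP; [right|left]; nra.
have S t (m : int) : t = m%:~R -> `|t - z e| <= 1 ->
    forall i, if i \in e :: r
      then exists2 m : int, setx y e t i = m%:~R & `|setx y e t i - z i| <= 1
      else setx y e t i = z i.
  move=> tm tz i; rewrite inE /setx; case: eqP => [->|_] /=; first by exists m.
  exact: yP.
move: Q; rewrite le_max => /orP[Q|Q].
  exists (setx y e u); first exact: le_trans qy Q.
  by apply: (S _ (Num.floor (z e))) => //; rewrite ler_norml; lra.
exists (setx y e (u + 1)); first exact: le_trans qy Q.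
apply: (S _ (Num.floor (z e) + 1)%R); first by rewrite intrD.
by rewrite ler_norml; lra.
Qed.

Let psdq M x := \sum_i \sum_j x i * M i j * x j.

(** Here [t *+ (i == e)] is entry [i] of [t] times the [e]-th unit vector. *)
Let psdq_add M x (e : 'I_n) (t : R) : (forall i j, M i j = M j i) ->
  psdq M (fun i => x i + t *+ (i == e)) =
  psdq M x + 2 * t * \sum_i x i * M i e + t ^+ 2 * M e e.
Proof.
move=> sM; rewrite /psdq.
have -> : \sum_i \sum_j (x i + t *+ (i == e)) * M i j * (x j + t *+ (j == e)) =
  \sum_i (\sum_j x i * M i j * x j + t * (x i * M i e)
   + (t *+ (i == e)) * ((\sum_j x j * M j e) + t * M e e)).
  apply: eq_bigr => i _.
  have -> : \sum_j (x i + t *+ (i == e)) * M i j * (x j + t *+ (j == e)) =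
      \sum_j (x i * M i j * x j + (t *+ (i == e)) * (M i j * x j)
        + (t *+ (j == e)) * ((x i + t *+ (i == e)) * M i j)).
    apply: eq_bigr => j _.
    by move: (t *+ (i == e)) (t *+ (j == e)) => u v; ring.
  rewrite !big_split /= -mulr_sumr.
  rewrite [X in _ + X](bigD1 e) //= eqxx [X in _ + (_ + X)]big1; last first.
    by move=> j /negPf ->; rewrite mulr0n mul0r.
  case: eqP => [->|_]; last by rewrite mulr1n !mulr0n; ring.
  have -> : \sum_j M e j * x j = \sum_j x j * M j e.
    by apply: eq_bigr => j _; rewrite (sM e j) mulrC.
  rewrite !mulr1n.
  by ring.
rewrite !big_split /= -mulr_sumr.
rewrite [X in _ + X](bigD1 e) //= eqxx [X in _ + (_ + X)]big1; last first.
  by move=> j /negPf ->; rewrite mulr0n mul0r.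
by rewrite mulr1n; ring.
Qed.

(** The form at the [i]-th unit vector plus [t] times the [e]-th. Keeping [t] free replaces
    determinants of two-by-two minors. *)
Lemma psdfun_minor M i e (t : R) : psdfun M ->
  0 <= M i i + 2 * t * M i e + t ^+ 2 * M e e.
Proof.
move=> [sM pM]; pose x j : R := 0 + 1 *+ (j == i).
have Exe : \sum_j x j * M j e = M i e.
  rewrite (bigD1 i) //= /x eqxx add0r mul1r big1 ?addr0 // => j /negPf ->.
  by rewrite add0r mul0r.
have := pM (fun j => x j + t *+ (j == e)).
rewrite -/(psdq M _) psdq_add // Exe.
rewrite /x (psdq_add (fun=> 0)) // /psdq.
rewrite [\sum_i _ * _]big1 => [|j _]; last by rewrite mul0r.
rewrite [\sum_i \sum_j _]big1 => [|j _]; last by rewrite big1 // => k _; rewrite !mul0r.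
by rewrite mulr0 !add0r expr1n mul1r.
Qed.

Lemma psdfun_diag_ge0 M e : psdfun M -> 0 <= M e e.
Proof. by move=> /(psdfun_minor e e 0); rewrite mulr0 mul0r expr0n mul0r !addr0. Qed.

Lemma psdfun_diag_eq0 M e : psdfun M -> M e e = 0 -> forall i, M i e = 0.
Proof.
move=> pM Me i; apply/eqP; apply: contraT => /eqP N0.
(* With [M e e = 0] the form is affine in [t], and this [t] gives it the value [-1]. *)
have := psdfun_minor i e (- (M i i + 1) / (2 * M i e)) pM; rewrite Me mulr0 addr0.
have -> : 2 * (- (M i i + 1) / (2 * M i e)) * M i e = - (M i i + 1).
  by field; apply/eqP.
lra.
Qed.

(** Completing the square: the Schur complement at [x] equals the form of [M] at [x] shifted by
    [- s / M e e] along the [e]-th axis. *)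
Lemma psdfun_schur M e : psdfun M -> M e e != 0 ->
  psdfun (fun i j => M i j - (M e e)^-1 * (M i e * M j e)).
Proof.
move=> [sM pM] Me; split=> [i j|x]; first by rewrite (sM i j) [M i e * _]mulrC.
pose s := \sum_i x i * M i e.
have -> : \sum_i \sum_j x i * (M i j - (M e e)^-1 * (M i e * M j e)) * x j =
    psdq M x - (M e e)^-1 * s ^+ 2.
  rewrite /psdq expr2 /s mulr_suml mulr_sumr -sumrB; apply: eq_bigr => i _.
  by rewrite mulr_sumr mulr_sumr -sumrB; apply: eq_bigr => j _; ring.
have := pM (fun i => x i + (- s / M e e) *+ (i == e)).
rewrite -/(psdq M _) psdq_add // -/s.
have -> // : psdq M x + 2 * (- s / M e e) * s + (- s / M e e) ^+ 2 * M e e =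
  psdq M x - (M e e)^-1 * s ^+ 2 by field.
Qed.

(* Eliminating one index at a time writes [M] as a sum of rank-one matrices. *)
Lemma psdfun_pairing_le c (L : R) M :
  (forall x, qform c x <= L * sqnorm x) -> psdfun M ->
  pairing c M <= L * \sum_i M i i.
Proof.
move=> cL.
(* [r] lists the rows that may be nonzero. If [M e e = 0], row [e] vanishes already; otherwise the
   Schur complement clears it. *)
suff H (r : seq 'I_n) : forall M, psdfun M ->
    (forall i j, i \notin r -> M i j = 0) -> pairing c M <= L * \sum_i M i i.
  by move=> pM; apply: (H (enum 'I_n)) => // i j; rewrite mem_enum.
elim: r => [|e r IH] {}M pM M0.
  by rewrite /pairing !big1 ?mulr0 // => i _; rewrite M0 ?mulr0.
have [Me|Me] := eqVneq (M e e) 0.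
  apply: IH => // i j ir; have [->|ie] := eqVneq i e.
    by rewrite pM.1 (psdfun_diag_eq0 pM).
  by apply: M0; rewrite inE negb_or ie.
have Me0 : 0 < M e e by rewrite lt_neqAle eq_sym Me psdfun_diag_ge0.
pose N i j := M i j - (M e e)^-1 * (M i e * M j e).
have pN : psdfun N by exact: psdfun_schur.
have N0 i j : i \notin r -> N i j = 0.
  rewrite /N => ir; have [->|ie] := eqVneq i e.
    by rewrite (pM.1 j e) mulrA mulVf // mul1r subrr.
  by rewrite !(M0 i) ?inE ?negb_or ?ie // mul0r mulr0 subr0.
have EM : pairing c M = pairing c N + (M e e)^-1 * qform c (M^~ e).
  rewrite /qform -pairingZ -pairingD; apply: eq_pairing => i j.
  by rewrite /N subrK.
have -> : \sum_i M i i = \sum_i N i i + (M e e)^-1 * sqnorm (M^~ e).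
  rewrite /sqnorm mulr_sumr -big_split /=; apply: eq_bigr => i _.
  by rewrite /N -expr2 subrK.
rewrite EM mulrDr; apply: lerD; first exact: IH.
by rewrite mulrCA ler_pM2l ?invr_gt0.
Qed.

End QuadraticForm.

(** * Lower bound on the trace of a feasible matrix *)

Section PositiveSemidefiniteMatrix.
Context {R : realType} {n : nat}.
Implicit Types (M : 'M[R]_n).

Lemma psdmxP M : psdmx M -> psdfun M.
Proof.
move=> [tM pM]; split=> [i j|x]; first by rewrite -[in LHS]tM mxE.
have := pM (\col_i x i); rewrite mxE.
rewrite (eq_bigr (fun j => \sum_i x i * M i j * x j)); last first.
  by move=> j _; rewrite !mxE mulr_suml; apply: eq_bigr => i _; rewrite !mxE.
by rewrite exchange_big.
Qed.

(** For [i] and its cyclic successor [j], [M i i + M j j >= 2 * M i j >= 2/n]; summing around the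
    cycle counts each diagonal entry twice. *)
Lemma feasible_trace_ge1 M : (2 <= n)%N -> feasible M -> 1 <= \tr M.
Proof.
move=> n2 [/psdmxP pM bM].
have n0 : (0 < n)%N by exact: ltnW.
have n0R : n%:R != 0 :> R by rewrite pnatr_eq0 -lt0n.
have E : \sum_(i < n) M (ordS i) (ordS i) = \tr M.
  by rewrite /mxtrace [RHS](reindex_inj (@ordS_inj n)).
have ne (i : 'I_n) : i != ordS i.
  apply/eqP => /(congr1 val) /=; have := ltn_ord i; rewrite leq_eqVlt => /orP[/eqP e|ei].
    by rewrite e modnn => i0; move: n2; rewrite -e i0.
  by rewrite modn_small // => /n_Sn.
have : \sum_(i < n) 2 * n%:R^-1 <= \sum_(i < n) (M i i + M (ordS i) (ordS i)).
  apply: ler_sum => i _; have /andP[h _] := bM _ _ (ne i).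
  have := psdfun_minor i (ordS i) (-1) pM; rewrite sqrrN expr1n; lra.
rewrite big_split /= E sumr_const card_ord -[_ *+ n]mulr_natr -mulrA mulVf // -/(\tr M).
lra.
Qed.

End PositiveSemidefiniteMatrix.

(** * Integer net controlling the quadratic form of random signs *)

Section Net.
Context {R : realType}.

(** Subgaussian bound for a random sign, with a generous constant that allows an elementary
    proof. *)
Lemma cosh_le (c : R) : 2^-1 * expR c + 2^-1 * expR (- c) <= expR (2 * c ^+ 2).
Proof.
wlog c0 : c / 0 <= c => [H|].
  have [c0|/ltW c0] := lerP 0 c; first exact: H.
  by have := H (- c); rewrite oppr_ge0 opprK sqrrN addrC; apply.
have [c1|/ltW c1] := lerP c 1; last first.
  have h : expR (- c) <= expR c by rewrite ler_expR; lra.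
  have : expR c <= expR (2 * c ^+ 2) by rewrite ler_expR; nra.
  lra.
(* With [a = exp (c/2)] and [a' = 1/a], [cosh c = 1 + (a - a')^2 / 2], and [a - a' <= 3c/2] for
   [c <= 1]. *)
pose u := c / 2.
have u0 : 0 <= u by rewrite /u; lra.
have cu : c = u + u by rewrite /u; lra.
pose a := expR u; pose a' := expR (- u).
have aa : a * a' = 1 by rewrite -expRD subrr expR0.
have a0 : 0 < a by exact: expR_gt0.
have a'1 : 1 - u <= a' by exact: expR_ge1Dx.
have a1 : 1 + u <= a by exact: expR_ge1Dx.
have ale : a * (1 - u) <= 1 by rewrite -[leRHS]aa ler_pM2l.
have -> : expR c = a ^+ 2 by rewrite cu expRD expr2.
have -> : expR (- c) = a' ^+ 2 by rewrite cu opprD expRD expr2.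
apply: le_trans (expR_ge1Dx _).
have u2 : u <= 2^-1 by rewrite /u; lra.
have d1 : a - a' <= 3 * u by nra.
have d0 : 0 <= a - a' by rewrite subr_ge0 ler_expR; lra.
have d2 : (a - a') ^+ 2 <= 9 * u ^+ 2.
  by rewrite (_ : 9 * u ^+ 2 = (3 * u) ^+ 2); [rewrite lerXn2r // nnegrE; lra | ring].
by rewrite cu; nra.
Qed.

Lemma sum_half_exp m : \sum_(k < m) (2^-1 : R) ^+ k <= 2.
Proof.
suff -> : \sum_(k < m) (2^-1 : R) ^+ k = 2 - 2 * 2^-1 ^+ m.
  by rewrite gerBl mulr_ge0 // exprn_ge0.
elim: m => [|m IH]; first by rewrite big_ord0 expr0; lra.
by rewrite big_ord_recr /= IH exprS; lra.
Qed.

Context {n : nat}.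
(** Entries of an integer vector of squared norm at most [4n] are at most [4n] in absolute value, so
    finitely many codes suffice. *)
Local Notation m := (4 * n).+1.
Implicit Types (y : {ffun 'I_n -> bool * 'I_m}) (c : 'I_n * 'I_n -> R).

(* A signed integer is encoded by its sign and its absolute value. *)
Definition netval y (i : 'I_n) : R := sgb (y i).1 * (y i).2%:R.

Definition in_net y : bool := (\sum_i (y i).2 ^ 2 <= 4 * n)%N.

(** Smooth substitute for a union bound: it dominates the excess of the form over [140 * sqrt n] on
    unit vectors, and its mean is easy to compute. *)
Definition net c : R :=
  \sum_(y | in_net y) expR (qform c (netval y) / Num.sqrt n%:R - 140 * n%:R).

Lemma net_ge0 c : 0 <= net c.
Proof. by apply: sumr_ge0 => y _; exact: expR_ge0. Qed.

Lemma netval_sqr y i : netval y i ^+ 2 = ((y i).2 ^ 2)%N%:R.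
Proof.
by rewrite /netval natrX exprMn; case: (y i).1; rewrite /= ?sqrrN expr1n mul1r.
Qed.

(** The vector is scaled to squared norm [n] and rounded to an integer vector without decreasing the
    form. The rounded vector lies in the net, and its own term of [net] covers the excess. *)
Lemma qform_le_net c (x : 'I_n -> R) : (0 < n)%N ->
  qform c x <= (140 * Num.sqrt n%:R + net c) * sqnorm x.
Proof.
move=> n0.
have n0R : 0 < n%:R :> R by rewrite ltr0n.
have [s0|s0] := eqVneq (sqnorm x) 0.
  rewrite s0 mulr0 /qform /pairing big1 // => k _.
  by rewrite (sqnorm_eq0 s0) mul0r mulr0.
set s := sqnorm x in s0 *.
have sp : 0 < s by rewrite lt_neqAle eq_sym s0 sqnorm_ge0.
pose a := Num.sqrt (n%:R / s).
have a2 : a ^+ 2 = n%:R / s by rewrite sqr_sqrtr // divr_ge0 // ltW.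
have [z [zx qz]] := qform_round c (fun i => a * x i).
rewrite qformZ a2 in qz.
have zsq : \sum_i (`|z i| ^ 2)%N%:R <= (4 * n)%:R :> R.
  have -> : (4 * n)%:R = \sum_(i < n) (2 * (a * x i) ^+ 2 + 2) :> R.
    rewrite big_split /= sumr_const card_ord -mulr_sumr.
    rewrite (eq_bigr (fun i => a ^+ 2 * x i ^+ 2)) => [|i _]; last by rewrite exprMn.
    rewrite -mulr_sumr -/(sqnorm x) -/s a2 divfK // natrM -mulr_natr.
    by ring.
  apply: ler_sum => i _; rewrite natrX natr_absz intr_norm real_normK ?num_real //.
  have := zx i; rewrite ler_norml => /andP[h1 h2].
  (* With [t = a * x i] and [|z - t| <= 1]: [z^2 + (z - 2t)^2 = 2t^2 + 2(z - t)^2 <= 2t^2 + 2]. *)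
  have := sqr_ge0 ((z i)%:~R - 2 * (a * x i)).
  nra.
have zn : (\sum_i `|z i| ^ 2 <= 4 * n)%N by rewrite -(ler_nat R) natr_sum.
have zm i : (`|z i| < m)%N.
  rewrite ltnS (leq_trans _ zn) // (bigD1 i) //= (leq_trans _ (leq_addr _ _)) //.
  by case: `|z i|%N => // k; rewrite -mulnn leq_pmulr.
pose y : {ffun 'I_n -> bool * 'I_m} := [ffun i => (0 <= z i, inord `|z i|)].
have yz i : netval y i = (z i)%:~R.
  rewrite /netval ffunE /= inordK // natr_absz; case: lerP => zi /=.
    by rewrite mul1r ger0_norm.
  by rewrite mulN1r ltr0_norm // intrN opprK.
have ny : in_net y.
  rewrite /in_net (eq_bigr (fun i => `|z i| ^ 2)%N) // => i _.
  by rewrite ffunE /= inordK.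
set q := qform c x in qz *.
pose q' := qform c (netval y).
have qz' : n%:R / s * q <= q'.
  by rewrite /q' (_ : netval y = fun i => (z i)%:~R) //; apply/funext.
pose r : R := Num.sqrt n%:R.
have r2 : r ^+ 2 = n%:R by rewrite sqr_sqrtr // ltW.
have r1 : 1 <= r by rewrite -sqrtr1 ler_sqrt // ler1n.
have r0 : 0 < r by lra.
pose u := q' / n%:R - 140 * r.
have un : u <= net c.
  rewrite /net (bigD1 y) //= -/q' -/r.
  have -> : q' / r - 140 * n%:R = r * u by rewrite /u -r2; field; lra.
  (* A single term suffices: [u <= exp (r * u)] because [r >= 1]. *)
  apply: (@le_trans _ _ (expR (r * u))); last first.
    by rewrite lerDl sumr_ge0 // => j _; exact: expR_ge0.
  have [u0|/ltW u0] := lerP u 0; first exact: le_trans u0 (expR_ge0 _).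
  by apply: le_trans (expR_ge1Dx _); nra.
have -> : q = s * ((n%:R / s * q) / n%:R) by field; rewrite s0 gt_eqF.
rewrite mulrC ler_pM2r //.
apply: (@le_trans _ _ (q' / n%:R)); first by rewrite ler_pM2r ?invr_gt0.
by rewrite -lerBlDl.
Qed.

(** Chernoff bound: the signs are independent and [cosh_le] bounds each factor. The exponents add up
    to at most [8 S^2 / n <= 128 n], since [S <= 4n]; the constant [140] leaves [-12 n]. *)
Lemma in_net_mgf y : (0 < n)%N -> in_net y ->
  bexp (fun=> 2^-1) (fun b : {ffun 'I_n * 'I_n -> bool} =>
    expR (qform (fun k => 2 * sgb (b k)) (netval y) / Num.sqrt n%:R
          - 140 * n%:R)) <= expR (- 12 * n%:R).
Proof.
move=> n0 ny; pose r : R := Num.sqrt n%:R.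
have n0R : 0 < n%:R :> R by rewrite ltr0n.
have r2 : r ^+ 2 = n%:R by rewrite sqr_sqrtr // ltW.
have r0 : 0 < r by rewrite sqrtr_gt0.
pose d (k : 'I_n * 'I_n) : R :=
  if (k.1 < k.2)%N then 2 * (netval y k.1 * netval y k.2) / r else 0.
have -> : (fun b : {ffun 'I_n * 'I_n -> bool} =>
    expR (qform (fun k => 2 * sgb (b k)) (netval y) / r - 140 * n%:R)) =
    (fun b => expR (- 140 * n%:R) * \prod_k expR (sgb (b k) * d k)).
  apply/funext => b; rewrite addrC expRD mulNr -expR_sum; congr (_ * expR _).
  rewrite /qform /pairing mulr_suml big_mkcond; apply: eq_bigr => k _.
  by rewrite /d; case: ifP => _; rewrite ?mulr0 //; ring.
rewrite bexpZ (bexp_prod _ (fun k t => expR (sgb t * d k))).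
have -> : - 12 * n%:R = - 140 * n%:R + 128 * n%:R :> R by ring.
rewrite expRD ler_pM2l ?expR_gt0 //.
pose S : R := \sum_i netval y i ^+ 2.
have S0 : 0 <= S by apply: sumr_ge0 => i _; exact: sqr_ge0.
have S4 : S <= 4 * n%:R.
  rewrite /S; under eq_bigr do rewrite netval_sqr.
  by rewrite -natr_sum -natrM ler_nat.
apply: (@le_trans _ _ (\prod_k expR (2 * d k ^+ 2))).
  apply: ler_prod => k _; rewrite addr_ge0 ?mulr_ge0 ?expR_ge0 ?invr_ge0 //=;
    last by lra.
  have -> : 1 - 2^-1 = 2^-1 :> R by lra.
  by rewrite mul1r mulN1r; exact: cosh_le.
rewrite -expR_sum ler_expR.
apply: (@le_trans _ _ (8 / n%:R * S ^+ 2)); last first.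
  apply: (@le_trans _ _ (8 / n%:R * (4 * n%:R) ^+ 2)).
    by rewrite ler_pM2l ?divr_gt0 // lerXn2r // nnegrE mulr_ge0.
  by rewrite le_eqVlt; apply/orP; left; apply/eqP; field; rewrite gt_eqF.
rewrite expr2 {1}/S big_distrlr /= pair_bigA mulr_sumr.
apply: ler_sum => k _; rewrite /d; case: ifP => _; last first.
  by rewrite expr0n mulr0 mulr_ge0 ?divr_ge0 // mulr_ge0 // sqr_ge0.
rewrite -r2 le_eqVlt; apply/orP; left; apply/eqP; field; lra.
Qed.

(** At most [exp (12 n)] net points, by a generating function: the absolute values of a net point
    sum to at most [4n], so the product of the factors [16 * 2^-|y i|] is at least [1]. *)
Lemma card_net : \sum_(y | in_net y) expR (- 12 * n%:R) <= 1 :> R.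
Proof.
pose w (k : bool * 'I_m) : R := expR (- 12) * (16 * 2^-1 ^+ k.2).
have w0 k : 0 <= w k by rewrite mulr_ge0 ?expR_ge0 // mulr_ge0 // exprn_ge0.
(* [64] is two signs, times [16], times the bound [2] on the geometric series. *)
have e12 : 64 * expR (- 12) <= 1 :> R.
  have e2 : 2 <= expR 1 :> R by have := expR_ge1Dx (1 : R); lra.
  have : 2 ^+ 12 <= expR 1 ^+ 12 :> R by rewrite lerXn2r // nnegrE ?expR_ge0.
  rewrite -expRM_natl mulr1 expRN => h.
  have : 64 <= expR 12 :> R by apply: le_trans h; rewrite -natrX ler_nat.
  by move=> h'; rewrite ler_pdivrMr ?mul1r ?expR_gt0.
have w1 : \sum_k w k <= 1.
  rewrite /w -mulr_sumr -mulr_sumr.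
  rewrite -(pair_bigA _ (fun (s : bool) (j : 'I_m) => (2^-1 : R) ^+ j)) /= big_bool /=.
  have := sum_half_exp m; have := expR_ge0 (- 12 : R); nra.
apply: (@le_trans _ _ (\sum_(y : {ffun 'I_n -> bool * 'I_m}) \prod_i w (y i))).
  rewrite [leRHS](bigID in_net) /=.
  apply: ler_wpDr; first by apply: sumr_ge0 => y _; apply: prodr_ge0.
  apply: ler_sum => y ny; rewrite /w big_split /= prodr_const card_ord.
  rewrite mulrC expRM_natl ler_peMr ?exprn_ge0 ?expR_ge0 //.
  have -> : \prod_i (16 * 2^-1 ^+ (y i).2 : R) =
      2 ^+ (4 * n) * 2^-1 ^+ (\sum_i (y i).2)%N.
    rewrite big_split /= prodr_const card_ord exprM -natrX; congr (_ * _).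
    by elim/big_rec2: _ => [|i u v _ ->]; rewrite ?expr0 // exprD.
  rewrite exprVn ler_pdivlMr ?exprn_gt0 // mul1r ler_eXn2l ?ltr1n //.
  apply: leq_trans ny; apply: leq_sum => i _.
  by case: ((y i).2 : nat) => // k; rewrite -mulnn leq_pmulr.
rewrite -(bigA_distr_bigA (fun i => w)) /=.
by apply: Num.Theory.prodr_ile1 => i _; rewrite sumr_ge0 ?w1.
Qed.

Lemma bexp_net : (0 < n)%N -> bexp (fun=> 2^-1)
  (fun b : {ffun 'I_n * 'I_n -> bool} => net (fun k => 2 * sgb (b k))) <= 1.
Proof.
move=> n0; rewrite bexp_sum; apply: le_trans card_net; apply: ler_sum => y ny.
exact: in_net_mgf.
Qed.

End Net.

(** * Size and Lipschitz constant of the logit *)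

Section Logit.
Context {R : realType}.

Definition logit (x : R) : R := ln x - ln (1 - x).

Lemma ln_ge_half (n : nat) : (2 <= n)%N -> 2^-1 <= ln n%:R :> R.
Proof.
move=> n2; have n0 : 0 < n%:R :> R by rewrite ltr0n ltnW.
have e0 : 0 < expR (2^-1) :> R by exact: expR_gt0.
have h : 1 - 2^-1 <= expR (- 2^-1) :> R by exact: expR_ge1Dx.
have e : expR (2^-1) * expR (- 2^-1) = 1 :> R by rewrite -expRD subrr expR0.
rewrite -[leLHS]expRK ler_ln ?posrE //.
apply: (@le_trans _ _ 2); last by rewrite ler_nat.
by nra.
Qed.

(** Follows from [ln (1 + t) <= t] at [t = (x - y) / y], with [1/y <= a]. *)
Lemma ln_sub_le (x y a : R) : 0 < a -> a^-1 <= y -> y <= x ->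
  ln x - ln y <= a * (x - y).
Proof.
move=> a0 ay yx; have ai : 0 < a^-1 by rewrite invr_gt0.
have y0 : 0 < y by exact: lt_le_trans ay.
have x0 : 0 < x by exact: lt_le_trans yx.
rewrite -ln_div ?posrE //.
have -> : x / y = 1 + (x - y) / y by field; rewrite gt_eqF.
apply: (@le_trans _ _ ((x - y) / y)).
  by apply: le_ln1Dx; rewrite (@lt_le_trans _ _ 0) // divr_ge0 ?subr_ge0 // ltW.
rewrite mulrC ler_wpM2r ?subr_ge0 // -[a]invrK lef_pV2 ?posrE //.
Qed.

Section Range.
Variables (a : R).
Hypothesis a1 : 1 < a.
Let a0 : 0 < a. Proof. exact: lt_trans a1. Qed.

Let ln_ge (x : R) : a^-1 <= x -> - ln a <= ln x.
Proof.
move=> ax; have ai : 0 < a^-1 by rewrite invr_gt0.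
by rewrite -lnV ?posrE // ler_ln ?posrE // (lt_le_trans ai).
Qed.

Let ln_lt0 (x : R) : a^-1 <= x <= 1 - a^-1 -> ln x <= 0 /\ ln (1 - x) <= 0.
Proof.
have ai : 0 < a^-1 by rewrite invr_gt0.
by move=> /andP[x0 x1]; split; apply: ln_le0; lra.
Qed.

Lemma logit_bounded (x : R) : a^-1 <= x <= 1 - a^-1 -> `|logit x| <= ln a.
Proof.
move=> x01; have [l1 l2] := ln_lt0 x01; have /andP[x0 x1] := x01.
have := ln_ge x0; have : - ln a <= ln (1 - x) by apply: ln_ge; lra.
by rewrite /logit ler_norml; lra.
Qed.

(** Both [x] and [1 - x] stay above [1/a], so each logarithm contributes a Lipschitz constant
    [a]. *)
Lemma logit_lipschitz (x y : R) :
  a^-1 <= x <= 1 - a^-1 -> a^-1 <= y <= 1 - a^-1 ->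
  `|logit x - logit y| <= 2 * a * `|x - y|.
Proof.
wlog yx : x y / y <= x => [H xr yr|].
  have [h|h] := orP (le_total y x); first exact: H.
  by rewrite distrC [`|x - y|]distrC; exact: H.
move=> /andP[x0 x1] /andP[y0 y1]; have ai : 0 < a^-1 by rewrite invr_gt0.
have h1 : ln y <= ln x by rewrite ler_ln ?posrE; lra.
have h2 : ln (1 - x) <= ln (1 - y) by rewrite ler_ln ?posrE; lra.
have h3 := ln_sub_le a0 y0 yx.
have h4 : ln (1 - y) - ln (1 - x) <= a * ((1 - y) - (1 - x)).
  by apply: ln_sub_le => //; lra.
rewrite /logit [X in X <= _]ger0_norm; last lra.
by rewrite ger0_norm; lra.
Qed.

End Range.
End Logit.

(** * Uniform bound on the penalized noise *)

Section Noise.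
Context {R : realType} {n : nat}.
Hypothesis n2 : (2 <= n)%N.
Implicit Types (M : 'M[R]_n) (p : 'I_n * 'I_n -> R)
  (b : {ffun 'I_n * 'I_n -> bool}).

Let n0 : (0 < n)%N. Proof. exact: ltnW. Qed.
Let nR2 : 2 <= n%:R :> R. Proof. by rewrite ler_nat. Qed.
Let nR0 : 0 < n%:R :> R. Proof. by rewrite ltr0n. Qed.
Let nR1 : 1 < n%:R :> R. Proof. by rewrite ltr1n. Qed.
Let lnn : 2^-1 <= ln n%:R :> R. Proof. exact: ln_ge_half. Qed.
Let ln0 : 0 <= ln n%:R :> R. Proof. exact: le_trans lnn. Qed.
Let r : R := Num.sqrt n%:R.
Let r0 : 0 <= r. Proof. exact: sqrtr_ge0. Qed.
Let r2 : r * r = n%:R. Proof. by rewrite -expr2 sqr_sqrtr. Qed.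

(** [700 = 5 * 140]: the factor [5 n ln n] of the linearized noise times the deterministic part
    [140 * sqrt n] of the bound on the form. *)
Definition penalty : R := 700 * n%:R * Num.sqrt n%:R * ln n%:R.

Lemma penalty_ge0 : 0 <= penalty.
Proof. exact: (mulr_ge0 (mulr_ge0 (mulr_ge0 (ler0n _ _) (ler0n _ _)) r0) ln0). Qed.

(** The penalty cannot absorb the product of [net] and the trace, hence the cut at [sqrt n]; larger
    traces are treated in [noise_le]. *)
Definition small_feasible : Type :=
  {M : 'M[R]_n | feasible M /\ \tr M <= Num.sqrt n%:R}.

(* The extra point [None] makes the supremum below nonnegative. *)
Definition noise_coef (k : 'I_n * 'I_n) (x : option small_feasible) : R :=
  if x is Some M then
    if (k.1 < k.2)%N then 2 * logit (sval M k.1 k.2) else 0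
  else 0.

(* The constant [ln n] dominates [|logit|], so that [noise_coef] is a
   contraction of [noise_lin] also across the point [None]. *)
Definition noise_lin (k : 'I_n * 'I_n) (x : option small_feasible) : R :=
  if x is Some M then
    if (k.1 < k.2)%N then 2 * (ln n%:R + 2 * n%:R * sval M k.1 k.2) else 0
  else 0.

Definition noise_pen (x : option small_feasible) : R :=
  if x is Some M then - (penalty * \tr (sval M)) else 0.

Definition noise_sup p b : R :=
  sup (range (fun x => \sum_k ((b k)%:R - p k) * noise_coef k x + noise_pen x)).

Let feasible_lt M (k : 'I_n * 'I_n) : feasible M -> (k.1 < k.2)%N ->
  n%:R^-1 <= M k.1 k.2 <= 1 - n%:R^-1.
Proof. by move=> [_ H] kk; apply: H; rewrite -val_eqE /= ltn_eqF. Qed.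

Let noise_lip k x y :
  `|noise_coef k x - noise_coef k y| <= `|noise_lin k x - noise_lin k y|.
Proof.
have nI : 0 < n%:R^-1 :> R by rewrite invr_gt0.
have H (M : small_feasible) : (k.1 < k.2)%N ->
    `|2 * logit (sval M k.1 k.2)| <= `|2 * (ln n%:R + 2 * n%:R * sval M k.1 k.2)|.
  case: M => M [fM tM] kk /=; have ran := feasible_lt fM kk.
  have hl := logit_bounded nR1 ran; have /andP[M0 _] := ran.
  have h : 0 <= 2 * n%:R * M k.1 k.2 by rewrite mulr_ge0 // ltW // (lt_le_trans nI).
  rewrite normrM [leRHS]ger0_norm; last by rewrite mulr_ge0 // addr_ge0.
  by rewrite ger0_norm // ler_pM2l // (le_trans hl) // lerDl.
case: x y => [M|] [N|] /=; last (by rewrite subrr normr0);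
  case: ifP => kk; rewrite ?subrr ?normr0 //.
- case: M N => M [fM tM] [N [fN tN]] /=.
  have := logit_lipschitz nR1 (feasible_lt fM kk) (feasible_lt fN kk).
  set u := logit _; set v := logit _ => h.
  have -> : 2 * u - 2 * v = 2 * (u - v) by ring.
  have -> : 2 * (ln n%:R + 2 * n%:R * M k.1 k.2) -
      2 * (ln n%:R + 2 * n%:R * N k.1 k.2) =
    2 * ((2 * n%:R) * (M k.1 k.2 - N k.1 k.2)) by ring.
  rewrite normrM [leRHS]normrM ler_wpM2l // normrM.
  by rewrite [`|2 * n%:R|]ger0_norm.
- by rewrite !subr0; exact: H.
- by rewrite !sub0r !normrN; exact: H.
Qed.

Let Bd : R := 2 * (ln n%:R + 2 * n%:R).

Let noise_linB k x : `|noise_lin k x| <= Bd.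
Proof.
have Bd0 : 0 <= Bd by rewrite /Bd mulr_ge0 // addr_ge0.
have nI : 0 < n%:R^-1 :> R by rewrite invr_gt0.
case: x => [[M [fM tM]]|] /=; last by rewrite normr0.
case: ifP => kk; last by rewrite normr0.
have /andP[M0 M1] := feasible_lt fM kk.
have h : 0 <= 2 * n%:R * M k.1 k.2 by rewrite mulr_ge0 // ltW // (lt_le_trans nI).
rewrite ger0_norm; last by rewrite mulr_ge0 // addr_ge0.
by rewrite /Bd ler_pM2l // lerD2l ler_piMr //; lra.
Qed.

Let noise_coefB k x : `|noise_coef k x| <= Bd.
Proof. by have := noise_lip k x None; rewrite !subr0 => /le_trans; apply. Qed.

Let noise_penB x : noise_pen x <= 0.
Proof.
case: x => [[M [fM tM]]|] //=; rewrite oppr_le0 mulr_ge0 ?penalty_ge0 //.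
by have := feasible_trace_ge1 n2 fM; lra.
Qed.

(** The constant part of [noise_lin] is [ln n] times the form at the all-ones vector, the rest a
    pairing with a positive semidefinite matrix. Both are at most multiples of [L]. *)
Lemma noise_lin_sup_le b x :
  \sum_k sgb (b k) * noise_lin k x + noise_pen x <=
  5 * n%:R * Num.sqrt n%:R * ln n%:R * net (fun k => 2 * sgb (b k)).
Proof.
set c := fun k => 2 * sgb (b k); have N0 := net_ge0 c.
case: x => [[M [fM tM]]|] /=; last first.
  by rewrite big1 ?add0r ?mulr_ge0 // => k _; rewrite mulr0.
have -> : \sum_k sgb (b k) * (if (k.1 < k.2)%N then
      2 * (ln n%:R + 2 * n%:R * M k.1 k.2) else 0) =
    ln n%:R * qform c (fun=> 1) + 2 * n%:R * pairing c M.
  rewrite /qform -!pairingZ -pairingD /pairing [RHS]big_mkcond.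
  by apply: eq_bigr => k _; rewrite /c; case: ifP => _; rewrite ?mulr0 //; ring.
set L := 140 * r + net c.
have q1 : qform c (fun=> 1) <= L * n%:R.
  have := qform_le_net c (fun=> 1) n0.
  by rewrite /sqnorm sumr_const card_ord expr1n.
have q2 : pairing c M <= L * \tr M.
  by apply: psdfun_pairing_le (psdmxP fM.1) => x; exact: qform_le_net.
have t1 := feasible_trace_ge1 n2 fM.
have L0 : 0 <= L by apply: addr_ge0 => //; exact: mulr_ge0 (ler0n _ _) r0.
have h1 : ln n%:R * qform c (fun=> 1) <= ln n%:R * (L * n%:R) by rewrite ler_wpM2l.
have h2 : 2 * n%:R * pairing c M <= 2 * n%:R * (L * \tr M).
  by rewrite ler_wpM2l // mulr_ge0.
(* From [1 <= \tr M] and [1/2 <= ln n]: the first term costs [1] and the second [4] of the factor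
   [5]. *)
have h3 : n%:R * ln n%:R + 2 * n%:R * \tr M <= 5 * n%:R * ln n%:R * \tr M.
  have e1 : ln n%:R * 1 <= ln n%:R * \tr M by rewrite ler_wpM2l.
  have e2 : 2^-1 * \tr M <= ln n%:R * \tr M by rewrite ler_wpM2r ?lnn; lra.
  have : n%:R * (ln n%:R + 2 * \tr M) <= n%:R * (5 * (ln n%:R * \tr M)).
    by rewrite ler_wpM2l //; lra.
  lra.
have h4 : L * (n%:R * ln n%:R + 2 * n%:R * \tr M) <=
    L * (5 * n%:R * ln n%:R * \tr M) by rewrite ler_wpM2l.
have h5 : 5 * n%:R * ln n%:R * net c * \tr M <= 5 * n%:R * ln n%:R * net c * r.
  by rewrite ler_wpM2l // !mulr_ge0.
(* The penalty cancels exactly the part [140 * r] of [L]; only [net] remains, times a trace at most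
   [r]. *)
have e : L * (5 * n%:R * ln n%:R * \tr M) - penalty * \tr M =
    5 * n%:R * ln n%:R * net c * \tr M by rewrite /L /penalty -/r; ring.
rewrite -/r; lra.
Qed.

Lemma bexp_noise_sup p : (forall k, 0 <= p k <= 1) ->
  bexp p (noise_sup p) <= penalty.
Proof.
move=> p01; have Bd0 : 0 <= Bd by rewrite /Bd mulr_ge0 // addr_ge0.
have penB x : noise_pen x <= Bd by exact: le_trans (noise_penB x) _.
apply: (le_trans (bexp_contraction None p01 noise_lip noise_coefB noise_linB penB)).
have C0 : 0 <= 5 * n%:R * r * ln n%:R by rewrite !mulr_ge0.
apply: (@le_trans _ _ (bexp (fun=> 2^-1)
    (fun b => 5 * n%:R * r * ln n%:R * net (fun k => 2 * sgb (b k))))).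
  apply: le_bexp => [k|b]; first by lra.
  by apply: (supr_le None) => x; exact: noise_lin_sup_le.
rewrite bexpZ; apply: (@le_trans _ _ (5 * n%:R * r * ln n%:R * 1)).
  by rewrite ler_wpM2l // bexp_net.
rewrite /penalty -/r; nra.
Qed.

Section Selection.
Variable p : 'I_n * 'I_n -> R.
Hypothesis p01 : forall k, 0 <= p k <= 1.

Let absp b k : `|(b k)%:R - p k| <= 1.
Proof.
have /andP[? ?] := p01 k; case: (b k).
  by rewrite ger0_norm ?subr_ge0 // gerBl.
by rewrite sub0r normrN ger0_norm.
Qed.

Let noise_sup_ge b x :
  \sum_k ((b k)%:R - p k) * noise_coef k x + noise_pen x <= noise_sup p b.
Proof.
apply: (@le_supr _ _
  (fun x => \sum_k ((b k)%:R - p k) * noise_coef k x + noise_pen x)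
  (\sum_(k : 'I_n * 'I_n) Bd + 0)) => y.
apply: lerD; last exact: noise_penB.
apply: ler_sum => k _; rewrite (le_trans (ler_norm _)) // normrM -[leRHS]mul1r.
exact: ler_pM.
Qed.

Lemma noise_sup_ge0 b : 0 <= noise_sup p b.
Proof.
have := noise_sup_ge b None; rewrite /= addr0 big1 // => k _.
by rewrite mulr0.
Qed.

(** Uniform in [M], hence applicable to an optimum that depends on the graph. A trace at most
    [sqrt n] enters the supremum; for a larger one, [n^2] terms of size at most [2 ln n] stay below
    [penalty * sqrt n = 700 n^2 ln n]. *)
Lemma noise_le b M : feasible M ->
  \sum_(k : 'I_n * 'I_n | (k.1 < k.2)%N) 2 * ((b k)%:R - p k) * logit (M k.1 k.2)
  <= noise_sup p b + penalty * \tr M.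
Proof.
move=> fM; have [tM|tM] := lerP (\tr M) r.
  have := noise_sup_ge b (Some (exist _ M (conj fM tM))).
  rewrite -lerBlDr /= => h; apply: le_trans h; rewrite big_mkcond.
  rewrite le_eqVlt; apply/orP; left; apply/eqP; congr (_ + _).
  by apply: eq_bigr => k _; case: ifP => _; rewrite ?mulr0 //; ring.
apply: (@le_trans _ _ (penalty * \tr M)); last first.
  by rewrite lerDr noise_sup_ge0.
apply: (@le_trans _ _ (penalty * r)); last first.
  by rewrite ler_wpM2l ?penalty_ge0 // ltW.
apply: (@le_trans _ _ (\sum_(k : 'I_n * 'I_n) 2 * ln n%:R)).
  rewrite big_mkcond; apply: ler_sum => k _; case: ifP => kk; last by rewrite mulr_ge0.
  rewrite (le_trans (ler_norm _)) // -mulrA normrM ger0_norm // ler_pM2l //.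
  rewrite normrM -[leRHS]mul1r ler_pM ?absp //.
  exact: logit_bounded nR1 _ (feasible_lt fM kk).
rewrite sumr_const card_prod card_ord -[_ *+ _]mulr_natr natrM /penalty -/r.
have -> : 700 * n%:R * r * ln n%:R * r = 700 * n%:R * (r * r) * ln n%:R by ring.
rewrite r2.
have : 0 <= ln n%:R * (n%:R * n%:R) :> R by rewrite !mulr_ge0.
lra.
Qed.

End Selection.
End Noise.

(** * Deterministic consequence of optimality *)

Section Optimality.
Context {R : realType} {n : nat}.
Implicit Types (A M P Q : 'M[R]_n) (C : R).

Lemma sum_offdiag (h : 'I_n -> 'I_n -> R) : (forall i j, h i j = h j i) ->
  \sum_i \sum_(j | i != j) h i j =
  \sum_(k : 'I_n * 'I_n | (k.1 < k.2)%N) 2 * h k.1 k.2.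
Proof.
move=> hs; rewrite pair_big_dep /= (bigID (fun k : 'I_n * 'I_n => (k.1 < k.2)%N)) /=.
have -> : \sum_(k : 'I_n * 'I_n | (k.1 != k.2) && (k.1 < k.2)%N) h k.1 k.2 =
    \sum_(k : 'I_n * 'I_n | (k.1 < k.2)%N) h k.1 k.2.
  by apply: eq_bigl => k; rewrite -val_eqE /=; case: ltngtP.
have -> : \sum_(k : 'I_n * 'I_n | (k.1 != k.2) && ~~ (k.1 < k.2)%N) h k.1 k.2 =
    \sum_(k : 'I_n * 'I_n | (k.1 < k.2)%N) h k.1 k.2.
  pose sw (k : 'I_n * 'I_n) := (k.2, k.1).
  have swI : injective sw by move=> [a b] [c d] [-> ->].
  rewrite (reindex_inj swI) /=; apply: eq_big => k; last by move=> _; exact: hs.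
  by rewrite -val_eqE /=; case: ltngtP.
by rewrite -big_split /=; apply: eq_bigr => k _; ring.
Qed.

Lemma regmod_objE C A M : adjacency A ->
  regmod_obj C A M = loglik A M - C * \tr M.
Proof.
move=> [_ A0 A01]; rewrite /regmod_obj /loglik; congr (_ - _).
rewrite -big_split /=; apply: eq_bigr => i _.
rewrite (big_mkcond (fun j => A i j == 1)) (big_mkcond (fun j => _ && _)) /=.
rewrite -big_split /= [RHS]big_mkcond; apply: eq_bigr => j _.
have [<-|ij] := eqVneq i j.
  by rewrite A0 eq_sym oner_eq0 addr0.
have [->|->] := A01 i j.
  by rewrite eqxx eq_sym oner_eq0 mul0r subr0 mul1r.
by rewrite eqxx oner_eq0 mul1r subrr mul0r.
Qed.

Hypothesis n2 : (2 <= n)%N.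

Lemma feasible_in01 M i j : feasible M -> i != j -> 0 < M i j < 1.
Proof.
have nI : 0 < n%:R^-1 :> R by rewrite invr_gt0 ltr0n ltnW.
by move=> [_ H] /H /andP[? ?]; apply/andP; split; lra.
Qed.

Lemma meanKLE P Q : feasible P -> feasible Q ->
  meanKL P Q = - (loglik P Q + entropy P) / (n%:R * (n%:R - 1)).
Proof.
move=> fP fQ.
transitivity (- (n%:R * (n%:R - 1))^-1 * (loglik P Q + entropy P)); last first.
  by rewrite mulrC mulrN mulNr.
rewrite /meanKL /loglik /entropy; congr (_ * _); rewrite -sumrB.
apply: eq_bigr => i _; rewrite -sumrB; apply: eq_bigr => j ij.
have /andP[P0 P1] := feasible_in01 fP ij; have /andP[Q0 Q1] := feasible_in01 fQ ij.
by rewrite !ln_div ?posrE ?subr_gt0 //; ring.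
Qed.

(** [loglik] is affine in its first argument with slope [logit Q], so replacing [P] by [A] costs
    exactly the noise sum. Comparing [Q] with the feasible competitor [P] then bounds [loglik A Q]
    from below. *)
Lemma meanKL_optimal_le C A P Q : adjacency A -> feasible P ->
  regmod_optimal C A Q ->
  meanKL P Q <=
  (\sum_(k : 'I_n * 'I_n | (k.1 < k.2)%N)
      2 * (A k.1 k.2 - P k.1 k.2) * logit (Q k.1 k.2)) / (n%:R * (n%:R - 1))
  + ((C * \tr P - C * \tr Q) / (n%:R * (n%:R - 1))
     - (loglik A P + entropy P) / (n%:R * (n%:R - 1))).
Proof.
move=> aA fP [fQ opt]; have := opt P fP; rewrite !regmod_objE // => h.
have sA i j : A i j = A j i by case: aA => tA _ _; rewrite -[in LHS]tA mxE.
have sP i j : P i j = P j i by exact: (psdmxP fP.1).1.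
have sQ i j : Q i j = Q j i by exact: (psdmxP fQ.1).1.
have E : loglik P Q = loglik A Q - \sum_(k : 'I_n * 'I_n | (k.1 < k.2)%N)
      2 * (A k.1 k.2 - P k.1 k.2) * logit (Q k.1 k.2).
  under [X in _ - X]eq_bigr do rewrite -mulrA.
  rewrite -(@sum_offdiag (fun i j => (A i j - P i j) * logit (Q i j))); last first.
    by move=> i j; rewrite sA sP sQ.
  rewrite /loglik -sumrB; apply: eq_bigr => i _; rewrite -sumrB.
  by apply: eq_bigr => j _; rewrite /logit; ring.
have N0 : 0 < n%:R * (n%:R - 1) :> R.
  by rewrite mulr_gt0 ?ltr0n ?subr_gt0 ?ltr1n // ltnW.
rewrite meanKLE // E -mulrBl -mulrDl ler_pM2r ?invr_gt0 //.
lra.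
Qed.

End Optimality.

(** * The random graph as a product of Bernoulli laws *)

Section RandomGraph.
Context {R : realType} {n : nat} {d : measure_display} {T : measurableType d}.
Variables (Pr : probability T R) (P : 'M[R]_n) (A : T -> 'M[R]_n).
Hypotheses (AP : random_graph Pr P A).

(** Positions on or below the diagonal are set to [false], matching the parameter [0] in
    [edge_prob], so that all pairs can serve as index set. *)
Definition edges (w : T) : {ffun 'I_n * 'I_n -> bool} :=
  [ffun k : 'I_n * 'I_n => (k.1 < k.2)%N && (A w k.1 k.2 == 1)].

Definition edge_prob (k : 'I_n * 'I_n) : R :=
  if (k.1 < k.2)%N then P k.1 k.2 else 0.

Let measurable_edge (i j : 'I_n) (B : set R) : measurable B ->
  measurable [set w | B (A w i j)].
Proof.
case: AP => mA _ _ _ mB.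
by have := mA i j measurableT B mB; rewrite setTI.
Qed.

Lemma measurable_edges c : measurable [set w | edges w = c].
Proof.
have -> : [set w | edges w = c] =
    \big[setI/[set: T]]_(k : 'I_n * 'I_n) [set w | edges w k = c k].
  apply/seteqP; split=> w /=.
    by move=> <-; elim/big_ind: _ => // X Y ? ?; split.
  move=> h; apply/ffunP => k; move: h; rewrite (bigD1 k) //= => -[] //.
apply: bigsetI_measurable => k _.
have -> : [set w | edges w k = c k] = [set w |
    (fun x : R => (k.1 < k.2)%N && (x == 1) = c k) (A w k.1 k.2)].
  by apply/seteqP; split=> w /=; rewrite ffunE.
apply: (@measurable_edge _ _ (fun x : R => (k.1 < k.2)%N && (x == 1) = c k)).
case: (k.1 < k.2)%N => /=; last first.
  case: (c k).
    by rewrite (_ : (fun=> _) = set0) //; apply/seteqP; split.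
  by rewrite (_ : (fun=> _) = setT) //; apply/seteqP; split.
case: (c k).
  rewrite (_ : (fun x => _) = [set 1]) //.
  by apply/seteqP; split=> x /=; [move/eqP | move=> ->; rewrite eqxx].
rewrite (_ : (fun x => _) = ~` [set 1]); first exact: measurableC.
by apply/seteqP; split=> x /=; [move/eqP | move=> h; apply/eqP].
Qed.

(** A configuration with [true] on or below the diagonal has probability zero on both sides.
    Otherwise independence applies above the diagonal, and the other factors are [1]. *)
Lemma prob_edges c :
  Pr [set w | edges w = c] = (\prod_k bern (edge_prob k) (c k))%:E.
Proof.
have [/existsP[k /andP[kk ck]]|/existsPn none] :=
    boolP [exists k : 'I_n * 'I_n, ~~ (k.1 < k.2)%N && c k].
  rewrite (_ : [set w | _] = set0); last first.
    apply/seteqP; split=> // w /= ec; move: ck; rewrite -ec ffunE.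
    by rewrite (negPf kk).
  by rewrite measure0 (bigD1 k) //= /edge_prob (negPf kk) ck mul0r.
case: AP => mA aA pA indA.
pose J := [set k : 'I_n * 'I_n | (k.1 < k.2)%N]%SET.
pose B (k : 'I_n * 'I_n) : set R := if c k then [set 1] else ~` [set 1].
have mB k : measurable (B k).
  by rewrite /B; case: (c k) => //; exact: measurableC.
rewrite (_ : [set w | _] = [set w | forall k, k \in J -> B k (A w k.1 k.2)]); last first.
  apply/seteqP; split=> w /=.
    move=> ec k; rewrite inE => kk; rewrite /B -ec ffunE kk /=.
    by case: eqP.
  move=> h; apply/ffunP => k; rewrite ffunE; have := h k; have := none k.
  rewrite inE; case: (k.1 < k.2)%N => /= [_ /(_ isT)|/negPf -> //].
  by rewrite /B; case: (c k) => /= [->|/eqP/negPf //]; rewrite eqxx.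
rewrite (indA J B) // [in RHS](bigID (mem J)) /= [X in (_ * X)%:E]big1 ?mulr1; last first.
  move=> k; rewrite inE => kk; have := none k; rewrite kk /= => /negPf ->.
  by rewrite /bern /edge_prob (negPf kk) subr0.
rewrite -prodEFin; apply: eq_bigr => k; rewrite inE => kk.
have pk := pA _ _ kk; rewrite /bern /edge_prob kk /B; case: (c k) => //.
rewrite -preimage_setC probability_setC; last first.
  exact: (@measurable_edge _ _ [set 1]).
by rewrite (_ : Pr _ = (P k.1 k.2)%:E) // EFinB.
Qed.

Let edges_sum (F : {ffun 'I_n * 'I_n -> bool} -> R) w :
  F (edges w) = \sum_c F c * \1_[set w | edges w = c] w.
Proof.
rewrite (bigD1 (edges w)) //= indicE mem_set // mulr1 big1 ?addr0 // => c cw.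
by rewrite indicE memNset ?mulr0 //= => e; move: cw; rewrite e eqxx.
Qed.

Lemma measurable_fun_edges (F : {ffun 'I_n * 'I_n -> bool} -> R) :
  measurable_fun setT (fun w => F (edges w)).
Proof.
rewrite (funext (edges_sum F)); apply: measurable_sum => c.
apply: measurable_funM => //; apply: measurable_indic; exact: measurable_edges.
Qed.

Lemma integral_edges (F : {ffun 'I_n * 'I_n -> bool} -> R) :
  (forall c, 0 <= F c) ->
  (\int[Pr]_w (F (edges w))%:E = (bexp edge_prob F)%:E)%E.
Proof.
move=> F0; under eq_integral do rewrite edges_sum -sumEFin.
rewrite ge0_integral_sum //; last 2 first.
- move=> c; apply/measurable_EFinP; apply: measurable_funM => //.
  by apply: measurable_indic; exact: measurable_edges.
- by move=> c w _; rewrite lee_fin mulr_ge0.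
rewrite /bexp -sumEFin; apply: eq_bigr => c _.
under eq_integral do rewrite EFinM.
rewrite ge0_integralZl_EFin //; last first.
  by apply/measurable_EFinP/measurable_indic; exact: measurable_edges.
rewrite integral_indic //; last exact: measurable_edges.
by rewrite setIT [X in (_ * X)%E](prob_edges c) -EFinM mulrC.
Qed.

End RandomGraph.

(** * Measurability of the quantities in the bound *)

Section Measurability.
Context {R : realType} {d : measure_display} {T : measurableType d}.

Lemma measurable_sum_cond (I : Type) (s : seq I) (p : pred I) (h : I -> T -> R) :
  (forall i, measurable_fun setT (h i)) ->
  measurable_fun setT (fun w => \sum_(i <- s | p i) h i w).
Proof.
move=> mh; under eq_fun do rewrite big_mkcond.
by apply: measurable_sum => i; case: (p i).
Qed.

Lemma measurable_trace (n : nat) (M : T -> 'M[R]_n) :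
  random_matrix M -> measurable_fun setT (fun w => \tr (M w)).
Proof. by move=> mM; apply: measurable_sum => i; exact: mM. Qed.

Lemma measurable_ln_comp (f : T -> R) :
  measurable_fun setT f -> measurable_fun setT (fun w => ln (f w)).
Proof. by move=> mf; apply: (@measurableT_comp _ _ _ _ _ _ (@ln R) _ f). Qed.

Lemma measurable_meanKL (n : nat) (P : 'M[R]_n) (M : T -> 'M[R]_n) :
  random_matrix M -> measurable_fun setT (fun w => meanKL P (M w)).
Proof.
move=> mM; rewrite /meanKL; apply: measurable_funM => //.
apply: measurable_sum => i; apply: measurable_sum_cond => j.
have m1 := mM i j.
apply: measurable_funD; apply: measurable_funM => //; apply: measurable_ln_comp;
  apply: measurable_funM => //.
exact: measurable_funB.
Qed.

Lemma measurable_loglik (n : nat) (P : 'M[R]_n) (A : T -> 'M[R]_n) :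
  random_matrix A -> measurable_fun setT (fun w => loglik (A w) P).
Proof.
move=> mA; rewrite /loglik.
apply: measurable_sum => i; apply: measurable_sum_cond => j.
have m1 := mA i j.
apply: measurable_funD; apply: measurable_funM => //.
exact: measurable_funB.
Qed.

End Measurability.

(** * Markov's inequality for nonnegative variables *)

Section MarkovBound.
Context {R : realType} {d : measure_display} {T : measurableType d}.
Variable Pr : probability T R.

Lemma markov_ge0 (G : T -> R) (a e : R) : measurable_fun setT G ->
  (forall w, 0 <= G w) -> 0 < a ->
  (\int[Pr]_w (G w)%:E <= (a * e)%:E)%E ->
  (Pr [set w | (a <= G w)%R] <= e%:E)%E.
Proof.
move=> mG G0 a0 intG.
have := le_integral_abse Pr measurableT (proj2 (measurable_EFinP _ _) mG) a0.
have -> : [set: T] `&` [set x | (a%:E <= `|(EFin \o G) x|)%E] =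
    [set w | a <= G w].
  by apply/seteqP; split=> w /=; rewrite lee_fin ger0_norm // => -[].
have -> : (\int[Pr]_x `|(EFin \o G) x| = \int[Pr]_w (G w)%:E)%E.
  by apply: eq_integral => w _ /=; rewrite ger0_norm.
move=> h; have := le_trans h intG.
by rewrite EFinM lee_pmul2l // ?lte_fin ?fin_numE.
Qed.

End MarkovBound.

(** * Combination of the noise bound, optimality and Markov's inequality *)

Theorem theorem3p11 (R : realType) :
  exists K : R, 0 < K /\
    forall (n : nat) (C delta : R),
      (2 <= n)%N -> 0 < C -> 0 < delta -> delta < 1 ->
    forall P : 'M[R]_n, feasible P ->
    forall (d : measure_display) (T : measurableType d) (Pr : probability T R)
      (A Pstar : T -> 'M[R]_n),
      random_graph Pr P A ->
      random_matrix Pstar ->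
      (forall w, regmod_optimal C (A w) (Pstar w)) ->
    ((1 - delta)%:E <=
      Pr [set w |
        (meanKL P (Pstar w))%:E <=
          (K * ln n%:R / (delta * Num.sqrt n%:R))%:E
            * 'E_Pr[fun w' => \tr (Pstar w')]
          + ((C * \tr P - C * \tr (Pstar w)) / (n%:R * (n%:R - 1))
             - (loglik (A w) P + entropy P) / (n%:R * (n%:R - 1)))%:E])%E.
Proof.
(* [2800 = 4 * 700]: one factor [2] from the mean of [G], the other from [n - 1 >= n/2]. *)
exists 2800; split; [by rewrite ltr0n | move=> n C delta n2 C0 d0 d1 P fP d T Pr A Pstar AP mPstar opt].
have nR0 : 0 < n%:R :> R by rewrite ltr0n ltnW.
have nR2 : 2 <= n%:R :> R by rewrite ler_nat.
have ln_half : 2^-1 <= ln n%:R :> R by exact: ln_ge_half.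
have ln0 : 0 < ln n%:R :> R by exact: lt_le_trans ln_half.
set r : R := Num.sqrt n%:R.
have r0 : 0 < r by rewrite sqrtr_gt0.
have r2 : r * r = n%:R by rewrite -expr2 sqr_sqrtr // ltW.
have k700 : 0 < 700 :> R by rewrite ltr0n.
have k2800 : 0 < 2800 :> R by rewrite ltr0n.
set c : R := 2800 * ln n%:R / (delta * r).
have c0 : 0 < c by apply: divr_gt0; [exact: (mulr_gt0 k2800 ln0) | exact: mulr_gt0].
set N : R := n%:R * (n%:R - 1).
have N0 : 0 < N by rewrite mulr_gt0 //; lra.
pose rest w : R := (C * \tr P - C * \tr (Pstar w)) / N
  - (loglik (A w) P + entropy P) / N.
pose lam : R := penalty (n := n).
have lam0 : 0 < lam by exact: (mulr_gt0 (mulr_gt0 (mulr_gt0 k700 nR0) r0) ln0).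
have tr1 w : 1 <= \tr (Pstar w) by exact: feasible_trace_ge1 n2 (opt w).1.
have mtr := measurable_trace mPstar.
have mtrE : measurable_fun setT (fun w => (\tr (Pstar w))%:E).
  exact/measurable_EFinP.
rewrite unlock.
set E := (\int[Pr]_w _)%E.
have E1 : (1 <= E)%E.
  have <- : (\int[Pr]_w (cst 1 w) = 1)%E.
    by rewrite integral_cst // mul1e; exact: probability_setT.
  by apply: ge0_le_integral => // w _; rewrite lee_fin // (le_trans _ (tr1 w)).
(* The expectation may be infinite; its coefficient is positive, so the event is then the whole
   space. *)
case EE : E E1 => [m| |] // E1; last first.
  rewrite gt0_muley ?lte_fin //.
  rewrite (_ : [set w | _] = setT) ?probability_setT ?lee_fin; first lra.
  by apply/seteqP; split=> // w _ /=; rewrite addye // leey.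
rewrite lee_fin in E1.
pose p := edge_prob P.
have p01 k : 0 <= p k <= 1.
  rewrite /p /edge_prob; case: ifP => kk; last by rewrite lexx ler01.
  have kne : k.1 != k.2 by rewrite -val_eqE /= ltn_eqF.
  by have /andP[/ltW -> /ltW ->] := feasible_in01 n2 fP kne.
pose Z w := noise_sup p (edges A w).
pose G w := Z w + lam * \tr (Pstar w).
have Z0 w : 0 <= Z w by exact: noise_sup_ge0.
have lt0 w : 0 <= lam * \tr (Pstar w).
  by rewrite mulr_ge0 ?(ltW lam0) // (le_trans _ (tr1 w)).
have mZ : measurable_fun setT Z by exact: measurable_fun_edges AP _.
have mlt : measurable_fun setT (fun w => lam * \tr (Pstar w)).
  exact: measurable_funM.
(* Markov threshold: [G] has mean at most [lam + lam * m <= 2 * lam * m], as [m >= 1]. *)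
pose a := 2 * lam * m / delta.
have a0 : 0 < a.
  apply: divr_gt0 d0; apply: mulr_gt0; first exact: mulr_gt0.
  exact: lt_le_trans E1.
have bad : (Pr [set w | (a <= G w)%R] <= delta%:E)%E.
  apply: markov_ge0 a0 _; [exact: measurable_funD | by move=> w; exact: addr_ge0 |].
  under eq_integral do rewrite EFinD.
  rewrite (@ge0_integralD _ _ _ Pr setT measurableT (EFin \o Z)
    (EFin \o (fun w => lam * \tr (Pstar w)))); last 4 first.
  - by move=> w _; rewrite lee_fin.
  - exact/measurable_EFinP.
  - by move=> w _; rewrite lee_fin.
  - exact/measurable_EFinP.
  rewrite /=.
  under [X in (_ + X)%E]eq_integral do rewrite EFinM.
  rewrite ge0_integralZl_EFin ?(ltW lam0) // => [|w _]; last first.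
    by rewrite lee_fin (le_trans _ (tr1 w)).
  rewrite -/E EE (integral_edges AP) => [|b]; last exact: noise_sup_ge0.
  rewrite -EFinM -EFinD lee_fin /a divfK ?gt_eqF //.
  have h1 : bexp p (noise_sup p) <= lam by exact: bexp_noise_sup.
  have h2 : lam * 1 <= lam * m by rewrite ler_pM2l.
  rewrite -/p; lra.
set S := [set w | _].
have mS : measurable S.
  rewrite (_ : S = setT `&` [set w | meanKL P (Pstar w) <= c * m + rest w]); last first.
    by apply/seteqP; split=> w; rewrite /S /= -EFinM -EFinD lee_fin // => -[].
  apply: measurable_fun_le => //; first exact: measurable_meanKL.
  apply: measurable_funD => //; rewrite /rest; apply: measurable_funB.
    apply: measurable_funM => //; apply: measurable_funB => //.
    exact: measurable_funM.
  apply: measurable_funM => //; apply: measurable_funD => //.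
  by apply: measurable_loglik; case: AP.
have Ncm : a <= N * (c * m).
  have -> : N * (c * m) = (n%:R - 1) * (n%:R * (2800 * ln n%:R) * m / (delta * r)).
    by rewrite /N /c; field; rewrite !gt_eqF.
  have -> : a = n%:R / 2 * (n%:R * (2800 * ln n%:R) * m / (delta * r)).
    by rewrite /a /lam /penalty -/r -r2; field; rewrite !gt_eqF.
  rewrite ler_pM2r; first by lra.
  apply: divr_gt0; last exact: mulr_gt0.
  apply: mulr_gt0; last exact: lt_le_trans E1.
  exact: (mulr_gt0 nR0 (mulr_gt0 k2800 ln0)).
(* Where the bound fails, the noise sum [Y] exceeds [N * (c * m) >= a], while [Y <= G]. *)
have SG : ~` S `<=` [set w | a <= G w].
  move=> w; rewrite /S /= -EFinM -EFinD lee_fin => /negP; rewrite -ltNge => hw.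
  have [_ aA _ _] := AP.
  have := meanKL_optimal_le n2 (aA w) fP (opt w); rewrite -/N -/(rest w).
  set Y := \sum_(k | _) _ => hY.
  have YG : Y <= G w.
    have := noise_le n2 p01 (edges A w) (opt w).1; rewrite -/(Z w) -/lam -/(G w).
    congr (_ <= _); apply: eq_bigr => k kk; rewrite /p /edge_prob kk ffunE kk /=.
    by have [_ _ /(_ k.1 k.2)[->|->]] := aA w; rewrite ?eqxx // eq_sym oner_eq0.
  have : c * m + rest w < Y / N + rest w by exact: lt_le_trans hw hY.
  rewrite ltrD2r ltr_pdivlMr // mulrC => /ltW h.
  exact: le_trans Ncm (le_trans h YG).
have : (Pr (~` S) <= delta%:E)%E.
  apply: le_trans bad; apply: le_measure; rewrite ?inE //; first exact: measurableC.
  rewrite -[X in measurable X]setTI; apply: measurable_fun_le => //.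
  exact: measurable_funD.
rewrite probability_setC // -(fineK (fin_num_measure Pr S mS)) -EFinB !lee_fin.
lra.
Qed.
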